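(* Let $\mathbf{k}$ be a field, $n\geq 2$, $A$ the free algebra on $n$ generators and $L$ the $n$th Leavitt algebra over $\mathbf{k}$. If $W\in \mathrm{Rep}(L)$, then the canonical map $j_W:W\to \Pi(\Lambda(W))$, $w\mapsto[I,w]$, is an isomorphism of $L$-modules. Moreover, the collection $(j_W:W\in\mathrm{Rep}(L))$ defines a natural isomorphism from the identity functor of $\mathrm{Rep}(L)$ to $\Pi\circ \Lambda$. In particular, any $W\in \mathrm{Rep}(L)$ is isomorphic to $\Pi(V)$ for a certain $V\in \mathrm{Rep}(A)$.
   Context: **Algebras and modules.** $A$ is the free unital $\mathbf{k}$-algebra on $e_1,\dots,e_n$. $L$ is the Leavitt algebra: the unital $\mathbf{k}$-algebra generated by $e_1,\dots,e_n,e_1^*,\dots,e_n^*$ with relations $\sum_{i=1}^n e_ie_i^*=1$ and $e_j^*e_k=\delta_{j,k}$. Representations are right modules, written $v\cdot b$, assumed unital; $\mathrm{Rep}(A)$, $\mathrm{Rep}(L)$ are the categories of unital right modules (of arbitrary dimension). $\Lambda:\mathrm{Rep}(L)\to\mathrm{Rep}(A)$ is restriction along the algebra morphism $\iota:A\to L$, $e_i\mapsto e_i$. **Trees.** A tree is a finite rooted planar tree in which each vertex has either $n$ ordered children or none (leaves). $I$ is the trivial tree with one vertex; the caret is the tree consisting of a root with $n$ leaves. $\mathcal T$ is the set of trees. Each leaf $\ell$ of a tree is identified with the word in the $e_i$'s describing the path from the root to $\ell$ ($e_i$ = go to the $i$th child). For $V\in\mathrm{Rep}(A)$ and a tree $t$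 let $\Phi(t):V\to V^{\mathrm{Leaf}(t)}$, $v\mapsto (v\cdot \ell)_{\ell\in\mathrm{Leaf}(t)}$. **The functor $\Pi:\mathrm{Rep}(A)\to\mathrm{Rep}(L)$.** $\Pi(V)$ is the set of classes $[t,v]$ of pairs $(t,v)$ with $t\in\mathcal T$, $v:\mathrm{Leaf}(t)\to V$, for the equivalence relation generated by: $(t,v)\sim(t',v')$ whenever $t'$ is obtained from $t$ by gluing a tree $s_\ell$ at each leaf $\ell$ of $t$, and $v'$ is obtained by decorating the leaves of $s_\ell$ with $\Phi(s_\ell)(v_\ell)$. Equivalently, $\Pi(V)$ is the vector space direct limit of the spaces $V^{\mathrm{Leaf}(t)}$. The $L$-action: if $t$ is the caret with trees $t_1,\dots,t_n$ glued at its leaves and $v_j$ is the restriction of $v$ to the leaves of $t_j$, then $[t,v]\cdot e_j=[t_j,v_j]$; and $[s,w]\cdot e_j^*$ is the class of the caret with $(s,w)$ glued at its $j$th leaf and its other leaves decorated by $0$. On morphisms, $\Pi(\theta)[t,v_1,\dots,v_k]=[t,\theta(v_1),\dots,\theta(v_k)]$. *)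

(* Defs.v *)
From HB Require Import structures.
From Stdlib Require Import Relation_Operators.
From mathcomp Require Import all_boot all_order all_algebra.
From mathcomp Require Import generic_quotient ring_quotient.
From mathcomp Require Import boolp.
From mathcomp Require Import finmap.
From mathcomp.multinomials Require Import monalg.

Set Implicit Arguments.
Unset Strict Implicit.
Unset Printing Implicit Defensive.

Import GRing.Theory.
Local Open Scope ring_scope.
Local Open Scope quotient_scope.

(* Right modules over a ring R are (left) modules over the converse ring R^c,
   the scaling by b : R^c being the right action of b : R. *)
Definition ract (R : pzRingType) (V : lmodType R^c) (v : V) (b : R) : V :=
  (b : R^c) *: v.

Notation "v ** b" := (ract v b) (at level 40, left associativity).

Section RightModules.
Variables (R : pzRingType) (V : lmodType R^c).
Implicit Types (u v : V) (a b : R).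

Lemma ractA v a b : v ** a ** b = v ** (a * b).
Proof. exact: scalerA. Qed.
Lemma ract1 v : v ** 1 = v.
Proof. exact: scale1r. Qed.
Lemma ractDl u v a : (u + v) ** a = u ** a + v ** a.
Proof. exact: scalerDr. Qed.
Lemma ractDr v a b : v ** (a + b) = v ** a + v ** b.
Proof. exact: scalerDl. Qed.
Lemma ract0l a : (0 : V) ** a = 0.
Proof. exact: scaler0. Qed.
Lemma ractNl v a : (- v) ** a = - (v ** a).
Proof. exact: scalerN. Qed.
Lemma ract_linear0 (W : lmodType R^c) (f : {linear V -> W}) : f 0 = 0.
Proof. exact: linear0. Qed.
Lemma ract_linear (W : lmodType R^c) (f : {linear V -> W}) v a :
  f (v ** a) = f v ** a.
Proof. exact: linearZ. Qed.
End RightModules.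

Lemma linear_ext (R : pzRingType) (U V : lmodType R) (f g : {linear U -> V}) :
  f =1 g -> f = g.
Proof.
case: f => f [[f1] [f2]]; case: g => g [[g1] [g2]] /= /funext fg.
by case: _ / fg in g1 g2 *; rewrite (Prop_irrelevance f1 g1) (Prop_irrelevance f2 g2).
Qed.

Definition free_alg (k : fieldType) (X : choiceType) : Type :=
  {malg k[{fmonom X}]}.

Section FreeAlgebra.
Variables (k : fieldType) (X : choiceType).
Notation F := (free_alg k X).

HB.instance Definition _ := GRing.Lalgebra.on F.

Lemma free_alg_scalerAr (c : k) (a b : F) : c *: (a * b) = a * (c *: b).
Proof.
apply/malgP => w; rewrite mcoeffZ (mcoeffMl a b).
rewrite (mcoeffMlw w (fsubset_refl (msupp a)) (msuppZ_le c b)).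
rewrite mulr_sumr; apply: eq_bigr => w1 _.
rewrite mulr_sumr; apply: eq_bigr => w2 _.
by rewrite mcoeffZ mulrnAr mulrCA.
Qed.

HB.instance Definition _ :=
  GRing.Lalgebra_isAlgebra.Build k F free_alg_scalerAr.

Definition gen (x : X) : F := << fmu x >>.

(* A vector space with an endomorphism f x for each x : X is a right module over
   the free algebra, x acting by f x. *)
Section Action.
Variables (M : lmodType k) (f : X -> {linear M -> M}).
Implicit Types (m : M) (a b : F) (w : seq X).

Definition word_act m w : M := foldl (fun m x => f x m) m w.

Definition free_act m a : M := \sum_(w <- msupp a) a@_w *: word_act m w.

Lemma word_actD w : {morph word_act^~ w : m1 m2 / m1 + m2}.
Proof. by elim: w => //= x w IH m1 m2; rewrite linearD IH. Qed.

Lemma word_actZ c w : {morph word_act^~ w : m / c *: m}.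
Proof. by elim: w => //= x w IH m; rewrite linearZ IH. Qed.

Lemma word_act_cat m w1 w2 : word_act m (w1 ++ w2) = word_act (word_act m w1) w2.
Proof. exact: foldl_cat. Qed.

Lemma free_actEw (d : {fset {fmonom X}}) m a : (msupp a `<=` d)%fset ->
  free_act m a = \sum_(w <- d) a@_w *: word_act m w.
Proof.
move=> le; rewrite /free_act (big_fset_incl _ le) //= => w _ /mcoeff_outdom ->.
by rewrite scale0r.
Qed.

Lemma free_actDr m : {morph free_act m : a b / a + b}.
Proof.
move=> a b; pose d := (msupp a `|` msupp b)%fset.
rewrite (@free_actEw d m a) ?fsubsetUl // (@free_actEw d m b) ?fsubsetUr //.
rewrite (@free_actEw d) ?msuppD_le // -big_split; apply: eq_bigr => w _.
by rewrite mcoeffD scalerDl.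
Qed.

Lemma free_actZr m c a : free_act m (c *: a) = c *: free_act m a.
Proof.
rewrite (free_actEw _ (msuppZ_le c a)) scaler_sumr; apply: eq_bigr => w _.
by rewrite mcoeffZ scalerA.
Qed.

Lemma free_actr0 m : free_act m 0 = 0.
Proof. by rewrite -[X in free_act m X](scale0r (0 : F)) free_actZr scale0r. Qed.

Lemma free_actNr m a : free_act m (- a) = - free_act m a.
Proof. by rewrite -(scaleN1r a) free_actZr scaleN1r. Qed.

Lemma free_actDl a : {morph free_act^~ a : m1 m2 / m1 + m2}.
Proof.
move=> m1 m2; rewrite -big_split; apply: eq_bigr => w _.
by rewrite word_actD scalerDr.
Qed.

Lemma free_actZl c m a : free_act (c *: m) a = c *: free_act m a.
Proof.
rewrite scaler_sumr; apply: eq_bigr => w _.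
by rewrite word_actZ !scalerA mulrC.
Qed.

Lemma free_act0l a : free_act 0 a = 0.
Proof. by rewrite -[X in free_act X a](scale0r (0 : M)) free_actZl scale0r. Qed.

Lemma free_act_mon m c (w : {fmonom X}) :
  free_act m (<< c *g w >> : {malg k[{fmonom X}]}) = c *: word_act m w.
Proof. by rewrite (free_actEw _ msuppU_le) big_seq_fset1 mcoeffUU. Qed.

Lemma free_act1 m : free_act m 1 = m.
Proof. by rewrite free_act_mon scale1r fm1. Qed.

Lemma free_act_gen m x : free_act m (gen x) = f x m.
Proof. by rewrite free_act_mon scale1r fmU. Qed.

Lemma free_act_suml (I : Type) (r : seq I) (G : I -> M) a :
  free_act (\sum_(i <- r) G i) a = \sum_(i <- r) free_act (G i) a.
Proof. exact: (big_morph (free_act^~ a) (free_actDl a) (free_act0l a)). Qed.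

Lemma free_act_sumr (I : Type) (r : seq I) (G : I -> F) m :
  free_act m (\sum_(i <- r) G i) = \sum_(i <- r) free_act m (G i).
Proof. exact: (big_morph (free_act m) (free_actDr m) (free_actr0 m)). Qed.

Lemma free_actM m a b : free_act m (a * b) = free_act (free_act m a) b.
Proof.
rewrite (malgME a b) free_act_sumr [free_act m a]/free_act free_act_suml.
apply: eq_bigr => w1 _; rewrite free_act_sumr free_actZl scaler_sumr.
apply: eq_bigr => w2 _.
by rewrite free_act_mon fmM word_act_cat scalerA.
Qed.

End Action.

Lemma free_act_morph (M N : lmodType k) (f : X -> {linear M -> M})
    (g : X -> {linear N -> N}) (h : {linear M -> N}) m a :
  (forall x m, h (f x m) = g x (h m)) ->
  h (free_act f m a) = free_act g (h m) a.
Proof.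
move=> hf; rewrite linear_sum; apply: eq_bigr => w _; rewrite linearZ /=.
by congr (_ *: _); elim: (w : seq X) m => //= x s IH m; rewrite IH hf.
Qed.

End FreeAlgebra.

Section Leavitt.
Variables (k : fieldType) (n : nat).

(* inl i stands for e_i and inr i for its star. *)
Notation F := (free_alg k ('I_n + 'I_n)%type).
Let fe (i : 'I_n) : F := gen k (inl i).
Let fs (i : 'I_n) : F := gen k (inr i).

Inductive leavitt_relator : F -> Prop :=
| Leavitt_sum : leavitt_relator (\sum_i fe i * fs i - 1)
| Leavitt_star i j : leavitt_relator (fs i * fe j - (i == j)%:R).

Definition two_sided_ideal (J : F -> Prop) : Prop :=
  [/\ J 0, forall a b, J a -> J b -> J (a - b)
    & forall a b c, J b -> J (a * b * c)].

Definition leavitt_ideal : {pred F} := fun a =>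
  `[< forall J, two_sided_ideal J -> (forall r, leavitt_relator r -> J r) -> J a >].

Lemma leavitt_ideal_zmod : zmod_closed leavitt_ideal.
Proof.
split=> [|a b /asboolP Ha /asboolP Hb]; apply/asboolP => J idJ rJ.
  by case: idJ.
by case: (idJ) => _ JB _; apply: JB; [apply: Ha | apply: Hb].
Qed.

HB.instance Definition _ :=
  GRing.isZmodClosed.Build F leavitt_ideal leavitt_ideal_zmod.

Lemma leavitt_idealM a b c : b \in leavitt_ideal -> a * b * c \in leavitt_ideal.
Proof.
move=> /asboolP Hb; apply/asboolP => J idJ rJ.
by case: (idJ) => _ _; apply; apply: Hb.
Qed.

Lemma leavitt_ideal_relator r : leavitt_relator r -> r \in leavitt_ideal.
Proof. by move=> rr; apply/asboolP => J _; apply. Qed.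

Definition leavitt : Type := {ideal_quot leavitt_ideal}.
HB.instance Definition _ := GRing.Zmodule.on leavitt.
Notation L := leavitt.

Definition leavitt_pi (a : F) : L := \pi_({ideal_quot leavitt_ideal}) a.

Lemma leavitt_repr (x : L) : leavitt_pi (repr x) = x.
Proof. exact: reprK. Qed.

Lemma leavitt_piP a b : leavitt_pi a = leavitt_pi b <-> a - b \in leavitt_ideal.
Proof.
have -> : (a - b \in leavitt_ideal) = (leavitt_pi a == leavitt_pi b).
  exact: Quotient.idealrBE.
by split => /eqP.
Qed.

Lemma leavitt_piD : {morph leavitt_pi : a b / a + b}.
Proof. exact: raddfD. Qed.

Lemma leavitt_pi0 : leavitt_pi 0 = 0.
Proof. exact: raddf0. Qed.

Definition leavitt_one : L := leavitt_pi 1.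
Definition leavitt_mul (x y : L) : L := leavitt_pi (repr x * repr y).
Definition leavitt_scale (c : k) (x : L) : L := leavitt_pi (c *: repr x).

Lemma leavitt_piM a b :
  leavitt_pi (a * b) = leavitt_mul (leavitt_pi a) (leavitt_pi b).
Proof.
apply/leavitt_piP; set a' := repr _; set b' := repr _.
have Ha : a - a' \in leavitt_ideal by apply/leavitt_piP; rewrite leavitt_repr.
have Hb : b - b' \in leavitt_ideal by apply/leavitt_piP; rewrite leavitt_repr.
have -> : a * b - a' * b' = 1 * (a - a') * b + a' * (b - b') * 1.
  by rewrite mul1r mulr1 mulrBl mulrBr addrA subrK.
by apply: rpredD; apply: leavitt_idealM.
Qed.

Lemma leavitt_piZ c a : leavitt_pi (c *: a) = leavitt_scale c (leavitt_pi a).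
Proof.
apply/leavitt_piP; set a' := repr _.
have Ha : a - a' \in leavitt_ideal by apply/leavitt_piP; rewrite leavitt_repr.
have -> : c *: a - c *: a' = (c *: 1) * (a - a') * 1.
  by rewrite mulr1 -scalerAl mul1r scalerBr.
exact: leavitt_idealM.
Qed.

Lemma leavitt_ind (P : L -> Prop) : (forall a, P (leavitt_pi a)) -> forall x, P x.
Proof. by move=> H x; rewrite -(leavitt_repr x). Qed.

Lemma leavitt_mulA : associative leavitt_mul.
Proof.
elim/leavitt_ind => a; elim/leavitt_ind => b; elim/leavitt_ind => c.
by rewrite -!leavitt_piM mulrA.
Qed.

Lemma leavitt_mul1 : left_id leavitt_one leavitt_mul.
Proof. by elim/leavitt_ind => a; rewrite -leavitt_piM mul1r. Qed.

Lemma leavitt_mulr1 : right_id leavitt_one leavitt_mul.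
Proof. by elim/leavitt_ind => a; rewrite -leavitt_piM mulr1. Qed.

Lemma leavitt_mulDl : left_distributive leavitt_mul +%R.
Proof.
elim/leavitt_ind => a; elim/leavitt_ind => b; elim/leavitt_ind => c.
by rewrite -leavitt_piD -!leavitt_piM mulrDl leavitt_piD.
Qed.

Lemma leavitt_mulDr : right_distributive leavitt_mul +%R.
Proof.
elim/leavitt_ind => a; elim/leavitt_ind => b; elim/leavitt_ind => c.
by rewrite -leavitt_piD -!leavitt_piM mulrDr leavitt_piD.
Qed.

(* The zero ring when n = 0, hence no structure of nzRingType or algType. *)
HB.instance Definition _ := GRing.Zmodule_isPzRing.Build L
  leavitt_mulA leavitt_mul1 leavitt_mulr1 leavitt_mulDl leavitt_mulDr.

Lemma leavitt_scalerA c d x :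
  leavitt_scale c (leavitt_scale d x) = leavitt_scale (c * d) x.
Proof. by elim/leavitt_ind: x => a; rewrite -!leavitt_piZ scalerA. Qed.

Lemma leavitt_scale1r : left_id 1 leavitt_scale.
Proof. by elim/leavitt_ind => a; rewrite -leavitt_piZ scale1r. Qed.

Lemma leavitt_scalerDr : right_distributive leavitt_scale +%R.
Proof.
move=> c; elim/leavitt_ind => a; elim/leavitt_ind => b.
by rewrite -leavitt_piD -!leavitt_piZ scalerDr leavitt_piD.
Qed.

Lemma leavitt_scalerDl x : {morph leavitt_scale^~ x : c d / c + d}.
Proof.
elim/leavitt_ind: x => a c d.
by rewrite -!leavitt_piZ scalerDl leavitt_piD.
Qed.

HB.instance Definition _ := GRing.Zmodule_isLmodule.Build k L
  leavitt_scalerA leavitt_scale1r leavitt_scalerDr leavitt_scalerDl.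

Lemma leavitt_piME a b : leavitt_pi (a * b) = leavitt_pi a * leavitt_pi b.
Proof. exact: leavitt_piM. Qed.

Lemma leavitt_piZE c a : leavitt_pi (c *: a) = c *: leavitt_pi a.
Proof. exact: leavitt_piZ. Qed.

Lemma leavitt_scalerAl (c : k) (x y : L) : c *: (x * y) = c *: x * y.
Proof.
elim/leavitt_ind: x => a; elim/leavitt_ind: y => b.
by rewrite -leavitt_piME -!leavitt_piZE -leavitt_piME scalerAl.
Qed.

Lemma leavitt_scalerAr (c : k) (x y : L) : c *: (x * y) = x * (c *: y).
Proof.
elim/leavitt_ind: x => a; elim/leavitt_ind: y => b.
by rewrite -leavitt_piME -!leavitt_piZE -leavitt_piME scalerAr.
Qed.

Definition leavitt_e (i : 'I_n) : L := leavitt_pi (fe i).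
Definition leavitt_es (i : 'I_n) : L := leavitt_pi (fs i).

Lemma leavitt_sum_e_es : \sum_i leavitt_e i * leavitt_es i = 1.
Proof.
transitivity (leavitt_pi (\sum_i fe i * fs i)); last first.
  by apply/leavitt_piP/leavitt_ideal_relator; exact: Leavitt_sum.
rewrite (big_morph leavitt_pi leavitt_piD leavitt_pi0).
by apply: eq_bigr => i _; rewrite leavitt_piME.
Qed.

Lemma leavitt_es_e i j : leavitt_es i * leavitt_e j = (i == j)%:R.
Proof.
transitivity (leavitt_pi (i == j)%:R); last first.
  by case: (i == j); rewrite ?leavitt_pi0.
rewrite -leavitt_piME; apply/leavitt_piP/leavitt_ideal_relator.
exact: Leavitt_star.
Qed.

End Leavitt.

Section Restriction.
Variables (k : fieldType) (n : nat).
Notation A := (free_alg k 'I_n).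
Notation L := (leavitt k n).

Definition leavitt_rmul (b x : L) : L := x * b.

Lemma leavitt_rmul_linear b : linear (leavitt_rmul b).
Proof. by move=> c x y; rewrite /leavitt_rmul mulrDl leavitt_scalerAl. Qed.

HB.instance Definition _ b :=
  GRing.isLinear.Build k L L *:%R (leavitt_rmul b) (leavitt_rmul_linear b).

Definition iota_alg (a : A) : L :=
  \sum_(w <- msupp a) a@_w *: \prod_(i <- (w : seq 'I_n)) leavitt_e k i.

Let er (i : 'I_n) : {linear L -> L} := leavitt_rmul (leavitt_e k i).

Lemma word_act_rmul x (w : seq 'I_n) :
  word_act er x w = x * \prod_(i <- w) leavitt_e k i.
Proof.
elim: w x => [|i w IH] x /=; first by rewrite big_nil mulr1.
by rewrite IH big_cons mulrA.
Qed.

Lemma free_act_rmul x a : free_act er x a = x * iota_alg a.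
Proof.
rewrite /iota_alg mulr_sumr; apply: eq_bigr => w _.
by rewrite word_act_rmul leavitt_scalerAr.
Qed.

Lemma iota_algE a : iota_alg a = free_act er 1 a.
Proof. by rewrite free_act_rmul mul1r. Qed.

Lemma iota_alg_linear : linear iota_alg.
Proof. by move=> c a b; rewrite !iota_algE free_actDr free_actZr. Qed.

Lemma iota_alg_monoid : monoid_morphism iota_alg.
Proof.
split=> [|a b]; first by rewrite iota_algE free_act1.
by rewrite iota_algE free_actM free_act_rmul -iota_algE.
Qed.

HB.instance Definition _ := GRing.isLinear.Build k A L *:%R iota_alg iota_alg_linear.
HB.instance Definition _ := GRing.isMonoidMorphism.Build A L iota_alg iota_alg_monoid.

Lemma iota_alg_gen i : iota_alg (gen k i) = leavitt_e k i.
Proof. by rewrite iota_algE free_act_gen /er /= /leavitt_rmul mul1r. Qed.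

Section Object.
Variable W : lmodType L^c.

Definition restriction : Type := W.
HB.instance Definition _ := GRing.Zmodule.on restriction.

Definition restriction_scale (a : A^c) (w : restriction) : restriction :=
  ract (w : W) (iota_alg a).

Lemma restriction_scalerA (a b : A^c) w :
  restriction_scale a (restriction_scale b w) = restriction_scale (a * b) w.
Proof. by rewrite /restriction_scale ractA -rmorphM. Qed.

Lemma restriction_scale1r : left_id 1 restriction_scale.
Proof. by move=> w; rewrite /restriction_scale rmorph1 ract1. Qed.

Lemma restriction_scalerDr : right_distributive restriction_scale +%R.
Proof. by move=> a v w; exact: ractDl. Qed.

Lemma restriction_scalerDl w : {morph restriction_scale^~ w : a b / a + b}.
Proof. by move=> a b; rewrite /restriction_scale raddfD ractDr. Qed.

HB.instance Definition _ := GRing.Zmodule_isLmodule.Build A^c restriction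
  restriction_scalerA restriction_scale1r restriction_scalerDr
  restriction_scalerDl.

Definition Lambda : lmodType A^c := restriction.

Lemma Lambda_ract (w : W) (a : A) : (w : Lambda) ** a = w ** iota_alg a.
Proof. by []. Qed.
End Object.

Section Morphism.
Variables (W W' : lmodType L^c) (f : {linear W -> W'}).

Definition Lambda_fun : Lambda W -> Lambda W' := f.

Lemma Lambda_fun_linear : linear Lambda_fun.
Proof. by move=> a v w; exact: (linearP f). Qed.

HB.instance Definition _ := GRing.isLinear.Build A^c (Lambda W) (Lambda W') *:%R
  Lambda_fun Lambda_fun_linear.

Definition Lambda_map : {linear Lambda W -> Lambda W'} := Lambda_fun.
End Morphism.

End Restriction.

Inductive tree (n : nat) : Type :=
| trivial_tree
| node of ('I_n -> tree n).
Arguments trivial_tree {n}.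

Section Trees.
Variable n : nat.
Notation tree := (tree n).

Fixpoint leaf (t : tree) : Type :=
  match t with
  | trivial_tree => unit
  | node f => {i : 'I_n & leaf (f i)}
  end.

Definition subleaf (f : 'I_n -> tree) i (l : leaf (f i)) : leaf (node f) :=
  existT (fun i => leaf (f i)) i l.

Fixpoint leaf_word (t : tree) : leaf t -> seq 'I_n :=
  match t with
  | trivial_tree => fun _ => [::]
  | node f => fun l => tag l :: leaf_word (tagged l)
  end.

Fixpoint glue (t : tree) : (leaf t -> tree) -> tree :=
  match t return (leaf t -> tree) -> tree with
  | trivial_tree => fun s => s tt
  | node f => fun s => node (fun i => glue (fun l => s (existT (fun i => leaf (f i)) i l)))
  end.

(* A leaf of [glue s] is a leaf l of t followed by a leaf of s l. *)
Fixpoint glue_leaf (t : tree) :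
    forall s : leaf t -> tree, leaf (glue s) -> {l : leaf t & leaf (s l)} :=
  match t return forall s : leaf t -> tree,
      leaf (glue s) -> {l : leaf t & leaf (s l)} with
  | trivial_tree => fun s m => existT (fun l => leaf (s l)) tt m
  | node f => fun s m =>
      let p := glue_leaf (tagged m) in
      existT (fun l => leaf (s l))
        (existT (fun i => leaf (f i)) (tag m) (tag p)) (tagged p)
  end.

Fixpoint depth (t : tree) : nat :=
  match t with
  | trivial_tree => 0%N
  | node f => (\max_(i < n) depth (f i)).+1
  end.

Fixpoint full_tree (N : nat) : tree :=
  if N is N'.+1 then node (fun _ => full_tree N') else trivial_tree.

Lemma size_leaf_full N (l : leaf (full_tree N)) : size (leaf_word l) = N.
Proof. by elim: N l => //= N IH [i l] /=; rewrite IH. Qed.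

End Trees.

Section DecoratedTrees.
Variables (k : fieldType) (n : nat).
Notation A := (free_alg k 'I_n).

Definition word_alg (w : seq 'I_n) : A := \prod_(i <- w) gen k i.

Lemma word_alg_nil : word_alg [::] = 1.
Proof. exact: big_nil. Qed.

Lemma word_alg_cons i w : word_alg (i :: w) = gen k i * word_alg w.
Proof. exact: big_cons. Qed.

Lemma word_alg_cat u w : word_alg (u ++ w) = word_alg u * word_alg w.
Proof. exact: big_cat. Qed.

Variable V : lmodType A^c.

Definition Phi (t : tree n) (v : V) : leaf t -> V :=
  fun l => v ** word_alg (leaf_word l).

Definition dtree : Type := {t : tree n & leaf t -> V}.

Definition decorate (t : tree n) (v : leaf t -> V) : dtree :=
  existT (fun t : tree n => leaf t -> V) t v.

HB.instance Definition _ := gen_eqMixin dtree.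
HB.instance Definition _ := gen_choiceMixin dtree.

Definition expand (t : tree n) (v : leaf t -> V) (s : leaf t -> tree n) : dtree :=
  decorate (fun m : leaf (glue s) =>
    let p := glue_leaf m in Phi (v (tag p)) (tagged p)).

Inductive expansion : dtree -> dtree -> Prop :=
| Expansion t v s : expansion (@decorate t v) (@expand t v s).

Definition dtree_equiv : rel dtree :=
  fun p q => `[< clos_refl_sym_trans dtree expansion p q >].

Lemma dtree_equiv_refl : reflexive dtree_equiv.
Proof. by move=> p; apply/asboolP; apply: rst_refl. Qed.

Lemma dtree_equiv_sym : symmetric dtree_equiv.
Proof.
by move=> p q; apply/asboolP/asboolP => H; apply: rst_sym.
Qed.

Lemma dtree_equiv_trans : transitive dtree_equiv.
Proof.
move=> q p r /asboolP pq /asboolP qr; apply/asboolP; exact: rst_trans pq qr.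
Qed.

Canonical dtree_equiv_rel :=
  EquivRel dtree_equiv dtree_equiv_refl dtree_equiv_sym dtree_equiv_trans.

Definition Pi_space : Type := {eq_quot dtree_equiv}.
HB.instance Definition _ := Choice.on Pi_space.

Definition dclass (p : dtree) : Pi_space := \pi_({eq_quot dtree_equiv}) p.

(* The value of (t, v) at a word l w, with l a leaf of t, is v_l . w; the value
   at a word going through no leaf is 0.  Two decorated trees are equivalent when
   they have the same values at all long enough words. *)
Fixpoint dvalue (t : tree n) : (leaf t -> V) -> seq 'I_n -> V :=
  match t return (leaf t -> V) -> seq 'I_n -> V with
  | trivial_tree => fun v w => v tt ** word_alg w
  | node f => fun v w =>
      if w is i :: w' then dvalue (fun l : leaf (f i) => v (subleaf l)) w' else 0
  end.

Definition value (p : dtree) : seq 'I_n -> V := dvalue (projT2 p).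

Definition ddepth (p : dtree) : nat := depth (projT1 p).

Definition sample (N : nat) (g : seq 'I_n -> V) : dtree :=
  decorate (fun l : leaf (full_tree n N) => g (leaf_word l)).

(* The caret, node (fun _ => trivial_tree), with p i glued at its ith leaf. *)
Definition graft (p : 'I_n -> dtree) : dtree :=
  @decorate (node (fun i => projT1 (p i)))
    (fun l => projT2 (p (tag l)) (tagged l)).

Lemma value_cat p u w : (ddepth p <= size u)%N ->
  value p (u ++ w) = value p u ** word_alg w.
Proof.
rewrite /ddepth /value; case: p => t v /=.
elim: t v u => [|f IH] v u /=; first by rewrite word_alg_cat ractA.
case: u => [|i u] //=; rewrite ltnS => le; apply: IH.
exact: leq_trans (leq_bigmax i) le.
Qed.

Lemma value_expansion p q w :
  expansion p q -> (ddepth q <= size w)%N -> value p w = value q w.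
Proof.
case=> t v s; rewrite /ddepth /value /=.
elim: t v s w => [|f IH] v s w /=; last first.
  case: w => [|i w] //; rewrite ltnS => le.
  apply: (IH i (fun l : leaf (f i) => v (subleaf l)) (fun l : leaf (f i) => s (subleaf l))).
  exact: leq_trans (leq_bigmax i) le.
move: (s tt) (v tt) => {v} t v; elim: t v w => [|f IH] v w /=.
  by rewrite /Phi /= word_alg_nil ract1.
case: w => [|i w] //; rewrite ltnS => le.
rewrite word_alg_cons -ractA (IH i _ w); last first.
  exact: leq_trans (leq_bigmax i) le.
by congr (dvalue _ w); apply/funext => l; rewrite /Phi /= word_alg_cons ractA.
Qed.

Lemma expand_sample p N : (ddepth p <= N)%N ->
  exists s, @expand (projT1 p) (projT2 p) s = sample N (value p).
Proof.
rewrite /ddepth /value; case: p => t v /=.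
elim: t v N => [|f IH] v N /=; first by exists (fun _ => full_tree n N).
case: N => [|N] //; rewrite ltnS => le.
have Hs i : {s : leaf (f i) -> tree n |
    expand (fun l : leaf (f i) => v (subleaf l)) s
      = sample N (dvalue (fun l : leaf (f i) => v (subleaf l)))}.
  by apply/cid/IH; exact: leq_trans (leq_bigmax i) le.
exists (fun l => sval (Hs (tag l)) (tagged l)).
transitivity (graft (fun i =>
  expand (fun l : leaf (f i) => v (subleaf l)) (sval (Hs i)))) => //.
transitivity (graft (fun i =>
  sample N (dvalue (fun l : leaf (f i) => v (subleaf l))))) => //.
by congr graft; apply/funext => i; exact: (svalP (Hs i)).
Qed.

Lemma dclassP p q :
  dclass p = dclass q <->
  exists N, forall w, (N <= size w)%N -> value p w = value q w.
Proof.
have eq_sample r N : (ddepth r <= N)%N -> dtree_equiv r (sample N (value r)).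
  move=> /expand_sample [s <-]; apply/asboolP/rst_step.
  by case: r s => t v s; exact: Expansion.
split=> [/eqmodP/asboolP|[N HN]].
  elim=> {p q} [p q pq|p|p q _ [N H]|p q r _ [N H] _ [N' H']].
  - by exists (ddepth q) => w; apply: value_expansion.
  - by exists 0%N.
  - by exists N => w /H.
  - exists (maxn N N') => w; rewrite geq_max => /andP[le le'].
    by rewrite H // H'.
pose M := maxn N (maxn (ddepth p) (ddepth q)).
apply/eqmodP; apply: (@dtree_equiv_trans (sample M (value p))).
  by apply: eq_sample; rewrite !leq_max leqnn !orbT.
rewrite dtree_equiv_sym.
have -> : sample M (value p) = sample M (value q).
  congr decorate; apply/funext => l; apply: HN.
  by rewrite size_leaf_full leq_maxl.
by apply: eq_sample; rewrite !leq_max leqnn !orbT.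
Qed.

Lemma value_sample N g w : (N <= size w)%N ->
  value (sample N g) w = g (take N w) ** word_alg (drop N w).
Proof.
rewrite /value /=; elim: N g w => [|N IH] g [|i w] //=.
by rewrite ltnS => le; rewrite (IH (fun u => g (i :: u))).
Qed.

End DecoratedTrees.

Section LongWords.
Variable n : nat.
Implicit Types P Q : seq 'I_n -> Prop.

Definition long_words P : Prop := exists N, forall w, (N <= size w)%N -> P w.

Lemma long_wordsT P : (forall w, P w) -> long_words P.
Proof. by move=> H; exists 0%N. Qed.

Lemma long_words_mp P Q :
  long_words P -> long_words (fun w => P w -> Q w) -> long_words Q.
Proof.
move=> [N HP] [N' HQ]; exists (maxn N N') => w.
by rewrite geq_max => /andP[/HP Pw /HQ]; apply.
Qed.

Lemma long_words_cons P i : long_words P -> long_words (fun w => P (i :: w)).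
Proof. by move=> [N H]; exists N => w le; apply: H; exact: leqW. Qed.

Lemma long_words_forall (P : 'I_n -> seq 'I_n -> Prop) :
  (forall i, long_words (P i)) -> long_words (fun w => forall i, P i w).
Proof.
move=> H; pose N i := sval (cid (H i)).
exists (\max_i N i)%N => w le i; apply: (svalP (cid (H i))).
exact: leq_trans (leq_bigmax i) le.
Qed.

Lemma long_words_cons_inv P :
  long_words (fun w => forall i, P (i :: w)) -> long_words P.
Proof. by move=> [N H]; exists N.+1 => -[|i w] // le; apply: H. Qed.
End LongWords.

Section Functoriality.
Variables (k : fieldType) (n : nat) (V V' : lmodType (free_alg k 'I_n)^c).

Definition dmap (g : V -> V') (p : dtree V) : dtree V' :=
  decorate (g \o projT2 p).

Lemma value_dmap (g : V -> V') p w :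
  g 0 = 0 -> (forall v a, g (v ** a) = g v ** a) ->
  value (dmap g p) w = g (value p w).
Proof.
move=> g0 gact; rewrite /value; case: p => t v /=.
by elim: t v w => [|f IH] v [|i w] /=; rewrite ?gact ?g0 // -IH.
Qed.
End Functoriality.

(* Locked, as unification diverges on scalings in {malg _[_]}. *)
HB.lock Definition free_const (k : fieldType) (X : choiceType) (c : k) :
  free_alg k X := c *: 1.

Section PiSpace.
Variables (k : fieldType) (n : nat).
Notation A := (free_alg k 'I_n).
Variable V : lmodType A^c.
Notation S := (Pi_space V).
Implicit Types (x y z : S) (p q : dtree V).

Definition kact (c : k) (v : V) : V := v ** free_const 'I_n c.

Lemma kactA c d v : kact c (kact d v) = kact (c * d) v.
Proof. by rewrite /kact ractA !unlock -scalerAl mul1r scalerA mulrC. Qed.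

Lemma kact_ract c v a : kact c (v ** a) = kact c v ** a.
Proof. by rewrite /kact !ractA unlock -scalerAl -scalerAr mul1r mulr1. Qed.

Lemma kact1 v : kact 1 v = v.
Proof. by rewrite /kact unlock scale1r ract1. Qed.

Lemma kactDl c u v : kact c (u + v) = kact c u + kact c v.
Proof. exact: ractDl. Qed.

Lemma kactDr c d v : kact (c + d) v = kact c v + kact d v.
Proof. by rewrite /kact !unlock scalerDl ractDr. Qed.

Lemma kact0l v : kact 0 v = 0.
Proof. by apply: (addrI (kact 0 v)); rewrite -kactDr !addr0. Qed.

Lemma kact0 c : kact c 0 = 0.
Proof. exact: ract0l. Qed.

Definition germ x : seq 'I_n -> V := value (repr x).

Lemma germ_dclass p : long_words (fun w => germ (dclass p) w = value p w).
Proof. by apply/dclassP; rewrite /dclass reprK. Qed.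

Lemma germ_eq x y : long_words (fun w => germ x w = germ y w) -> x = y.
Proof. by move=> /dclassP; rewrite /dclass !reprK. Qed.

Lemma germ_cat x :
  long_words (fun u => forall w, germ x (u ++ w) = germ x u ** word_alg k w).
Proof. by exists (ddepth (repr x)) => u le w; apply: value_cat. Qed.

(* The sum is computed on a common refinement of the two trees, a complete tree
   of large depth; see also Pi_classD below. *)
Definition dadd p q : dtree V :=
  sample (maxn (ddepth p) (ddepth q)) (fun w => value p w + value q w).

Lemma value_dadd p q :
  long_words (fun w => value (dadd p q) w = value p w + value q w).
Proof.
exists (maxn (ddepth p) (ddepth q)) => w le; rewrite value_sample // ractDl.
move: (maxn _ _) (leq_maxl (ddepth p) (ddepth q)) (leq_maxr (ddepth p) (ddepth q)) le.
move=> N leP leQ le.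
by rewrite -!value_cat ?size_takel // cat_take_drop.
Qed.

Definition dzero : dtree V := @decorate _ _ V trivial_tree (fun _ => 0).

Definition Pi_zero : S := dclass dzero.
Definition Pi_add x y : S := dclass (dadd (repr x) (repr y)).
Definition Pi_opp x : S := dclass (dmap (@GRing.opp V) (repr x)).
Definition Pi_scale (c : k) x : S := dclass (dmap (kact c) (repr x)).

Lemma germ_zero : long_words (fun w => germ Pi_zero w = 0).
Proof.
apply: (long_words_mp (germ_dclass dzero)); apply: long_wordsT => w ->.
exact: ract0l.
Qed.

Lemma germ_add x y : long_words (fun w => germ (Pi_add x y) w = germ x w + germ y w).
Proof.
apply: (long_words_mp (germ_dclass (dadd (repr x) (repr y)))); apply: (long_words_mp (value_dadd (repr x) (repr y))).
by apply: long_wordsT => w -> ->.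
Qed.

Lemma germ_opp x : long_words (fun w => germ (Pi_opp x) w = - germ x w).
Proof.
apply: (long_words_mp (germ_dclass (dmap (@GRing.opp V) (repr x)))); apply: long_wordsT => w ->.
by rewrite value_dmap ?oppr0 // => v a; rewrite ractNl.
Qed.

Lemma germ_scale c x : long_words (fun w => germ (Pi_scale c x) w = kact c (germ x w)).
Proof.
apply: (long_words_mp (germ_dclass (dmap (kact c) (repr x)))); apply: long_wordsT => w ->.
by rewrite value_dmap // => [|v a]; [exact: kact0 | exact: kact_ract].
Qed.

Lemma Pi_addA : associative Pi_add.
Proof.
move=> x y z; apply: germ_eq.
apply: (long_words_mp (germ_add x (Pi_add y z))); apply: (long_words_mp (germ_add y z)).
apply: (long_words_mp (germ_add (Pi_add x y) z)); apply: (long_words_mp (germ_add x y)).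
by apply: long_wordsT => w e1 -> e2 ->; rewrite e2 e1 addrA.
Qed.

Lemma Pi_addC : commutative Pi_add.
Proof.
move=> x y; apply: germ_eq.
apply: (long_words_mp (germ_add x y)); apply: (long_words_mp (germ_add y x)).
by apply: long_wordsT => w -> ->; rewrite addrC.
Qed.

Lemma Pi_add0 : left_id Pi_zero Pi_add.
Proof.
move=> x; apply: germ_eq.
apply: (long_words_mp (germ_add Pi_zero x)); apply: (long_words_mp germ_zero).
by apply: long_wordsT => w -> ->; rewrite add0r.
Qed.

Lemma Pi_addN : left_inverse Pi_zero Pi_opp Pi_add.
Proof.
move=> x; apply: germ_eq.
apply: (long_words_mp (germ_add (Pi_opp x) x)); apply: (long_words_mp germ_zero).
apply: (long_words_mp (germ_opp x)).
by apply: long_wordsT => w -> -> ->; rewrite addNr.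
Qed.

HB.instance Definition _ :=
  GRing.isZmodule.Build S Pi_addA Pi_addC Pi_add0 Pi_addN.

Lemma Pi_scalerA c d x : Pi_scale c (Pi_scale d x) = Pi_scale (c * d) x.
Proof.
apply: germ_eq.
apply: (long_words_mp (germ_scale c (Pi_scale d x))).
apply: (long_words_mp (germ_scale d x)); apply: (long_words_mp (germ_scale (c * d) x)).
by apply: long_wordsT => w -> -> ->; rewrite kactA.
Qed.

Lemma Pi_scale1r : left_id 1 Pi_scale.
Proof.
move=> x; apply: germ_eq; apply: (long_words_mp (germ_scale 1 x)).
by apply: long_wordsT => w ->; rewrite kact1.
Qed.

Lemma Pi_scalerDr : right_distributive Pi_scale +%R.
Proof.
move=> c x y; apply: germ_eq.
apply: (long_words_mp (germ_scale c (x + y))); apply: (long_words_mp (germ_add x y)).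
apply: (long_words_mp (germ_add (Pi_scale c x) (Pi_scale c y))).
apply: (long_words_mp (germ_scale c x)); apply: (long_words_mp (germ_scale c y)).
by apply: long_wordsT => w e1 e2 e3 e4 e5; rewrite e5 e4 e3 e2 e1 kactDl.
Qed.

Lemma Pi_scalerDl x : {morph Pi_scale^~ x : c d / c + d}.
Proof.
move=> c d; apply: germ_eq.
apply: (long_words_mp (germ_scale (c + d) x)).
apply: (long_words_mp (germ_add (Pi_scale c x) (Pi_scale d x))).
apply: (long_words_mp (germ_scale c x)); apply: (long_words_mp (germ_scale d x)).
by apply: long_wordsT => w e1 e2 e3 e4; rewrite e4 e3 e2 e1 kactDr.
Qed.

HB.instance Definition _ := GRing.Zmodule_isLmodule.Build k S
  Pi_scalerA Pi_scale1r Pi_scalerDr Pi_scalerDl.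

Lemma germD x y : long_words (fun w => germ (x + y) w = germ x w + germ y w).
Proof. exact: germ_add. Qed.

Lemma germZ c x : long_words (fun w => germ (c *: x) w = kact c (germ x w)).
Proof. exact: germ_scale. Qed.

Lemma germ_sum (I : Type) (r : seq I) (F : I -> S) :
  long_words (fun w => germ (\sum_(i <- r) F i) w = \sum_(i <- r) germ (F i) w).
Proof.
elim: r => [|i r IH].
  apply: (long_words_mp germ_zero).
  by apply: long_wordsT => w e; rewrite !big_nil.
apply: (long_words_mp IH).
apply: (long_words_mp (germD (F i) (\sum_(i <- r) F i))).
by apply: long_wordsT => w e1 e2; rewrite !big_cons e1 e2.
Qed.

(* When t is trivial, (t, v) is first expanded to the caret decorated by the
   v . e_i. *)
Definition dedge (j : 'I_n) p : dtree V :=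
  match p with
  | existT trivial_tree v => @decorate _ _ V trivial_tree (fun _ => v tt ** gen k j)
  | existT (node f) v => decorate (fun l : leaf (f j) => v (subleaf l))
  end.

Definition dstar (j : 'I_n) p : dtree V :=
  graft (fun i => if i == j then p else dzero).

Lemma value_dedge j p w : value (dedge j p) w = value p (j :: w).
Proof.
by case: p => [[|f] v] //=; rewrite /value /= word_alg_cons ractA.
Qed.

Lemma value_graft (q : 'I_n -> dtree V) i w :
  value (graft q) (i :: w) = value (q i) w.
Proof. by []. Qed.

Lemma value_dstar j p i w :
  value (dstar j p) (i :: w) = if i == j then value p w else 0.
Proof.
by rewrite value_graft; case: (i == j) => //; rewrite /value /= ract0l.
Qed.

Definition Pi_edge (j : 'I_n) x : S := dclass (dedge j (repr x)).
Definition Pi_star (j : 'I_n) x : S := dclass (dstar j (repr x)).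

Lemma germ_edge j x : long_words (fun w => germ (Pi_edge j x) w = germ x (j :: w)).
Proof.
apply: (long_words_mp (germ_dclass (dedge j (repr x)))); apply: long_wordsT => w ->.
exact: value_dedge.
Qed.

Lemma germ_star j x : long_words (fun w => forall i,
  germ (Pi_star j x) (i :: w) = if i == j then germ x w else 0).
Proof.
apply: long_words_forall => i.
apply: (long_words_mp (long_words_cons i (germ_dclass (dstar j (repr x))))).
by apply: long_wordsT => w ->; exact: value_dstar.
Qed.

Lemma Pi_edge_dclass j p : Pi_edge j (dclass p) = dclass (dedge j p).
Proof.
apply: germ_eq; apply: (long_words_mp (germ_edge j (dclass p))).
apply: (long_words_mp (long_words_cons j (germ_dclass p))).
apply: (long_words_mp (germ_dclass (dedge j p))).
by apply: long_wordsT => w -> e ->; rewrite e value_dedge.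
Qed.

Lemma Pi_star_dclass j p : Pi_star j (dclass p) = dclass (dstar j p).
Proof.
apply: germ_eq; apply: long_words_cons_inv.
apply: (long_words_mp (germ_star j (dclass p))).
apply: (long_words_mp (germ_dclass p)).
apply: long_words_mp (long_words_forall
  (fun i => long_words_cons i (germ_dclass (dstar j p)))) _.
apply: long_wordsT => w e1 e2 e3 i.
by rewrite e1 e3 e2 value_dstar.
Qed.

Lemma Pi_edge_linear j : linear (Pi_edge j).
Proof.
move=> c x y; apply: germ_eq.
apply: (long_words_mp (germ_edge j (c *: x + y))).
apply: (long_words_mp (long_words_cons j (germD (c *: x) y))).
apply: (long_words_mp (long_words_cons j (germZ c x))).
apply: (long_words_mp (germD (c *: Pi_edge j x) (Pi_edge j y))).
apply: (long_words_mp (germZ c (Pi_edge j x))).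
apply: (long_words_mp (germ_edge j x)); apply: (long_words_mp (germ_edge j y)).
by apply: long_wordsT => w e1 e2 e3 e4 e5 e6 e7;
  rewrite e7 e6 e5 e4 e3 e2 e1.
Qed.

Lemma Pi_star_linear j : linear (Pi_star j).
Proof.
move=> c x y; apply: germ_eq; apply: long_words_cons_inv.
apply: (long_words_mp (germ_star j (c *: x + y))).
apply: (long_words_mp (germD (c *: x) y)); apply: (long_words_mp (germZ c x)).
apply: long_words_mp (long_words_forall
  (fun i => long_words_cons i (germD (c *: Pi_star j x) (Pi_star j y)))) _.
apply: long_words_mp (long_words_forall
  (fun i => long_words_cons i (germZ c (Pi_star j x)))) _.
apply: (long_words_mp (germ_star j x)); apply: (long_words_mp (germ_star j y)).
apply: long_wordsT => w e1 e2 e3 e4 e5 e6 e7 i.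
rewrite e7 e6 e5 e4 e3 e2 e1; case: (i == j) => //.
by rewrite kact0 addr0.
Qed.

HB.instance Definition _ j :=
  GRing.isLinear.Build k S S *:%R (Pi_edge j) (Pi_edge_linear j).
HB.instance Definition _ j :=
  GRing.isLinear.Build k S S *:%R (Pi_star j) (Pi_star_linear j).

Lemma Pi_star_edge i j x : Pi_edge j (Pi_star i x) = (i == j)%:R *: x.
Proof.
apply: germ_eq.
apply: (long_words_mp (germ_edge j (Pi_star i x))).
apply: (long_words_mp (germ_star i x)).
apply: (long_words_mp (germZ (i == j)%:R x)).
apply: long_wordsT => w e1 e2 e3; rewrite e3 e2 e1 eq_sym.
by case: (i == j); rewrite ?kact1 ?kact0l.
Qed.

Lemma Pi_edge_star_sum x : \sum_i Pi_star i (Pi_edge i x) = x.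
Proof.
apply: germ_eq; apply: long_words_cons_inv.
apply: long_words_mp (long_words_forall (fun i => long_words_cons i
  (germ_sum (index_enum 'I_n) (fun j => Pi_star j (Pi_edge j x))))) _.
apply: long_words_mp (long_words_forall
  (fun j => germ_star j (Pi_edge j x))) _.
apply: long_words_mp (long_words_forall (fun j => germ_edge j x)) _.
apply: long_wordsT => w e1 e2 e3 i; rewrite e3.
under eq_bigr do rewrite e2.
by rewrite (bigD1 i) //= eqxx e1 big1 ?addr0 // => j /negbTE;
  rewrite eq_sym => ->.
Qed.

End PiSpace.

Section Pi.
Variables (k : fieldType) (n : nat).
Notation A := (free_alg k 'I_n).
Notation L := (leavitt k n).
Notation F := (free_alg k ('I_n + 'I_n)%type).

Section Object.
Variable V : lmodType A^c.
Notation S := (Pi_space V).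

Definition Pi_letter (x : 'I_n + 'I_n) : {linear S -> S} :=
  match x with inl i => @Pi_edge k n V i | inr i => @Pi_star k n V i end.

Notation act := (free_act Pi_letter).

Lemma Pi_letter_ideal (x : S) (a : F) : a \in @leavitt_ideal k n -> act x a = 0.
Proof.
move=> /asboolP /(_ (fun a => forall x, act x a = 0)) H.
move: x; apply: H => [|r [|i j] x].
- split=> [x|b c Hb Hc x|b c d Hc x]; first exact: free_actr0.
  + by rewrite free_actDr free_actNr Hb Hc subrr.
  + by rewrite !free_actM Hc free_act0l.
- rewrite free_actDr free_actNr free_act1 free_act_sumr.
  under eq_bigr do rewrite free_actM !free_act_gen.
  by apply/eqP; rewrite subr_eq0; apply/eqP; exact: Pi_edge_star_sum.
- rewrite free_actDr free_actNr free_actM !free_act_gen /= Pi_star_edge.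
  by rewrite -(scaler_nat (i == j) (1 : F)) free_actZr free_act1 subrr.
Qed.

Definition Pi_carrier : Type := S.
HB.instance Definition _ := GRing.Zmodule.on Pi_carrier.

Definition Pi_act (b : L^c) (x : Pi_carrier) : Pi_carrier := act x (repr (b : L)).

Lemma Pi_act_pi (a : F) x : Pi_act (leavitt_pi a) x = act x a.
Proof.
apply/eqP; rewrite -subr_eq0 -free_actNr -free_actDr; apply/eqP.
by apply/Pi_letter_ideal/leavitt_piP; rewrite leavitt_repr.
Qed.

Lemma Pi_actA (b c : L^c) x : Pi_act b (Pi_act c x) = Pi_act (b * c) x.
Proof.
elim/leavitt_ind: b => b; elim/leavitt_ind: c => c.
rewrite (Pi_act_pi c) (Pi_act_pi b) -free_actM -Pi_act_pi.
by rewrite (leavitt_piME c b).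
Qed.

Lemma Pi_act1 : left_id 1 Pi_act.
Proof. by move=> x; rewrite -[1]/(leavitt_pi 1) Pi_act_pi free_act1. Qed.

Lemma Pi_actDr : right_distributive Pi_act +%R.
Proof. by move=> b x y; exact: free_actDl. Qed.

Lemma Pi_actDl x : {morph Pi_act^~ x : b c / b + c}.
Proof.
elim/leavitt_ind => b; elim/leavitt_ind => c.
rewrite (Pi_act_pi b) (Pi_act_pi c) -free_actDr -Pi_act_pi.
by rewrite (leavitt_piD b c).
Qed.

HB.instance Definition _ := GRing.Zmodule_isLmodule.Build L^c Pi_carrier
  Pi_actA Pi_act1 Pi_actDr Pi_actDl.

Definition Pi : lmodType L^c := Pi_carrier.

Definition Pi_class (t : tree n) (v : leaf t -> V) : Pi := dclass (decorate v).

Lemma Pi_classP (t s : tree n) (v : leaf t -> V) (w : leaf s -> V) :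
  Pi_class v = Pi_class w <->
  clos_refl_sym_trans (dtree V) (@expansion k n V) (decorate v) (decorate w).
Proof. by split => [/eqmodP/asboolP|H] //; apply/eqmodP/asboolP. Qed.

Lemma Pi_class_surj (x : Pi) : exists t, exists v : leaf t -> V, x = Pi_class v.
Proof.
have : dclass (repr (x : Pi_space V)) = x by exact: reprK.
by case: (repr _) => t v <-; exists t, v.
Qed.

Lemma Pi_classD t (v w : leaf t -> V) :
  Pi_class v + Pi_class w = Pi_class (fun l => v l + w l).
Proof.
apply: germ_eq.
apply: (long_words_mp (germD (dclass (decorate v)) (dclass (decorate w)))).
apply: (long_words_mp (germ_dclass (decorate v))).
apply: (long_words_mp (germ_dclass (decorate w))).
apply: (long_words_mp (germ_dclass (decorate (fun l => v l + w l)))).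
apply: long_wordsT => u e1 e2 e3 e4.
rewrite e4 e3 e2 e1 /value /= {e1 e2 e3 e4}.
by elim: t v w u => [|f IH] v w [|i u] //=; rewrite ?ractDl ?addr0.
Qed.

Lemma Pi_classZ t (v : leaf t -> V) (c : k) :
  Pi_class v ** (c *: (1 : L)) = Pi_class (fun l => v l ** (c *: (1 : A))).
Proof.
transitivity (dclass (dmap (kact c) (decorate v))); last first.
  congr (dclass (decorate _)).
  by apply/funext => l; rewrite /= /kact unlock.
transitivity (c *: (dclass (decorate v))); last first.
  apply: germ_eq.
  apply: (long_words_mp (germZ c (dclass (decorate v)))).
  apply: (long_words_mp (germ_dclass (decorate v))).
  apply: (long_words_mp (germ_dclass (dmap (kact c) (decorate v)))).
  apply: long_wordsT => u e1 e2 e3; rewrite e1 e3 e2.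
  by rewrite value_dmap ?kact0 // => x a; rewrite kact_ract.
have -> : c *: dclass (decorate v) = act (dclass (decorate v)) (c *: (1 : F)).
  by rewrite free_actZr free_act1.
rewrite -(Pi_act_pi (c *: (1 : F))) (leavitt_piZE c 1).
exact: erefl.
Qed.

Lemma Pi_class_e (f : 'I_n -> tree n) (v : leaf (node f) -> V) j :
  Pi_class v ** leavitt_e k j = Pi_class (fun l : leaf (f j) => v (subleaf l)).
Proof.
rewrite /ract -[LHS]/(Pi_act _ _) Pi_act_pi free_act_gen.
exact: Pi_edge_dclass.
Qed.

Lemma Pi_class_es (t : tree n) (v : leaf t -> V) j :
  Pi_class v ** leavitt_es k j =
  dclass (graft (fun i => if i == j then decorate v else dzero V)).
Proof.
rewrite /ract -[LHS]/(Pi_act _ _) Pi_act_pi free_act_gen.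
exact: Pi_star_dclass.
Qed.
End Object.

Section Morphism.
Variables (V V' : lmodType A^c) (g : {linear V -> V'}).

Definition Pi_fun (x : Pi V) : Pi V' := dclass (dmap g (repr (x : Pi_space V))).

Lemma value_dmap_lin p w : value (dmap g p) w = g (value p w).
Proof. by apply: value_dmap => [|v a]; [exact: ract_linear0 | exact: ract_linear]. Qed.

Lemma germ_Pi_fun x : long_words (fun w => germ (Pi_fun x) w = g (germ x w)).
Proof.
apply: (long_words_mp (germ_dclass (dmap g (repr (x : Pi_space V))))).
by apply: long_wordsT => w ->; exact: value_dmap_lin.
Qed.

Lemma Pi_fun_class t (v : leaf t -> V) :
  Pi_fun (Pi_class v) = Pi_class (fun l => g (v l)).
Proof.
apply: germ_eq; apply: (long_words_mp (germ_Pi_fun (Pi_class v))).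
apply: (long_words_mp (germ_dclass (decorate v))).
apply: (long_words_mp (germ_dclass (dmap g (decorate v)))).
by apply: long_wordsT => w e1 e2 e3; rewrite e3 e2 e1 value_dmap_lin.
Qed.

Definition Pi_klin : Pi_space V -> Pi_space V' := Pi_fun.

Lemma Pi_klin_linear : linear Pi_klin.
Proof.
move=> c x y; apply: germ_eq.
apply: (long_words_mp (germ_Pi_fun (c *: x + y))).
apply: (long_words_mp (germD (c *: x) y)); apply: (long_words_mp (germZ c x)).
apply: (long_words_mp (germD (c *: Pi_klin x) (Pi_klin y))).
apply: (long_words_mp (germZ c (Pi_klin x))).
apply: (long_words_mp (germ_Pi_fun x)); apply: (long_words_mp (germ_Pi_fun y)).
apply: long_wordsT => w e1 e2 e3 e4 e5 e6 e7.
rewrite e7 e6 e5 e4 e3 e2 e1 /kact -ract_linear; exact: raddfD.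
Qed.

HB.instance Definition _ :=
  GRing.isLinear.Build k (Pi_space V) (Pi_space V') *:%R Pi_klin Pi_klin_linear.

Lemma Pi_klin_letter i x : Pi_klin (Pi_letter V i x) = Pi_letter V' i (Pi_klin x).
Proof.
case: i => i /=; apply: germ_eq.
  apply: (long_words_mp (germ_Pi_fun (Pi_edge i x))).
  apply: (long_words_mp (germ_edge i x)).
  apply: (long_words_mp (germ_edge i (Pi_klin x))).
  apply: (long_words_mp (long_words_cons i (germ_Pi_fun x))).
  by apply: long_wordsT => w e1 e2 e3 e4; rewrite e4 e3 e2 e1.
apply: long_words_cons_inv.
apply: long_words_mp (long_words_forall
  (fun j => long_words_cons j (germ_Pi_fun (Pi_star i x)))) _.
apply: (long_words_mp (germ_star i x)).
apply: (long_words_mp (germ_star i (Pi_klin x))).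
apply: (long_words_mp (germ_Pi_fun x)).
apply: long_wordsT => w e1 e2 e3 e4 j; rewrite e4 e3 e2 e1.
by case: (j == i) => //; exact: ract_linear0.
Qed.

Lemma Pi_fun_linear : linear Pi_fun.
Proof.
move=> b x y.
have -> : Pi_fun (b *: x + y) = Pi_fun (b *: x) + Pi_fun y.
  exact: (linearD Pi_klin).
congr (_ + _); apply: (free_act_morph (h := Pi_klin)).
exact: Pi_klin_letter.
Qed.

HB.instance Definition _ :=
  GRing.isLinear.Build L^c (Pi V) (Pi V') *:%R Pi_fun Pi_fun_linear.

Definition Pi_map : {linear Pi V -> Pi V'} := Pi_fun.
End Morphism.
End Pi.

Record category := Category {
  obj :> Type;
  hom : obj -> obj -> Type;
  idm : forall a, hom a a;
  compm : forall a b c, hom b c -> hom a b -> hom a c;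
  compmA : forall a b c d (h : hom c d) (g : hom b c) (f : hom a b),
    compm h (compm g f) = compm (compm h g) f;
  comp1m : forall a b (f : hom a b), compm (idm b) f = f;
  compm1 : forall a b (f : hom a b), compm f (idm a) = f
}.
Arguments idm {_} a.

Record functor (C D : category) := Functor {
  fobj :> C -> D;
  fmor : forall a b : C, hom a b -> hom (fobj a) (fobj b);
  fmor1 : forall a : C, fmor (idm a) = idm (fobj a);
  fmorM : forall (a b c : C) (g : hom b c) (f : hom a b),
    fmor (compm g f) = compm (fmor g) (fmor f)
}.

Section Categories.
Variables C D E : category.

Definition id_functor : functor C C :=
  @Functor C C id (fun _ _ f => f) (fun _ => erefl) (fun _ _ _ _ _ => erefl).

Lemma comp_functor1 (G : functor D E) (F : functor C D) (a : C) :
  fmor G (fmor F (idm a)) = idm (G (F a)).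
Proof. by rewrite !fmor1. Qed.

Lemma comp_functorM (G : functor D E) (F : functor C D) (a b c : C)
    (g : hom b c) (f : hom a b) :
  fmor G (fmor F (compm g f)) = compm (fmor G (fmor F g)) (fmor G (fmor F f)).
Proof. by rewrite !fmorM. Qed.

Definition comp_functor (G : functor D E) (F : functor C D) : functor C E :=
  @Functor C E (fun a => G (F a)) (fun _ _ f => fmor G (fmor F f))
    (comp_functor1 G F) (@comp_functorM G F).

Definition is_iso (a b : C) (f : hom a b) : Prop :=
  exists g : hom b a, compm g f = idm a /\ compm f g = idm b.

Definition isomorphic (a b : C) : Prop := exists f : hom a b, is_iso f.
End Categories.

Definition is_natural (C D : category) (F G : functor C D)
    (eta : forall a : C, hom (F a) (G a)) : Prop :=
  forall (a b : C) (f : hom a b),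
    compm (eta b) (fmor F f) = compm (fmor G f) (eta a).

Definition is_natural_iso (C D : category) (F G : functor C D)
    (eta : forall a : C, hom (F a) (G a)) : Prop :=
  is_natural eta /\ forall a, is_iso (eta a).

Section Rep.
Variable R : pzRingType.

Definition lin_id (V : lmodType R^c) : {linear V -> V} := idfun.
Definition lin_comp (U V W : lmodType R^c) (g : {linear V -> W})
  (f : {linear U -> V}) : {linear U -> W} := g \o f.

Lemma lin_compA (U V W X : lmodType R^c) (h : {linear W -> X})
    (g : {linear V -> W}) (f : {linear U -> V}) :
  lin_comp h (lin_comp g f) = lin_comp (lin_comp h g) f.
Proof. exact: linear_ext. Qed.

Lemma lin_comp1 (U V : lmodType R^c) (f : {linear U -> V}) :
  lin_comp (lin_id V) f = f.
Proof. exact: linear_ext. Qed.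

Lemma lin_1comp (U V : lmodType R^c) (f : {linear U -> V}) :
  lin_comp f (lin_id U) = f.
Proof. exact: linear_ext. Qed.

Definition Rep : category :=
  @Category (lmodType R^c) (fun U V => {linear U -> V}) lin_id lin_comp
    lin_compA lin_comp1 lin_1comp.
End Rep.

Section Functors.
Variables (k : fieldType) (n : nat).
Notation A := (free_alg k 'I_n).
Notation L := (leavitt k n).

Lemma Lambda_map1 (W : Rep L) : Lambda_map (lin_id W) = lin_id (Lambda W).
Proof. exact: linear_ext. Qed.

Lemma Lambda_mapM (U V W : Rep L) (g : {linear V -> W}) (f : {linear U -> V}) :
  Lambda_map (lin_comp g f) = lin_comp (Lambda_map g) (Lambda_map f).
Proof. exact: linear_ext. Qed.

Definition Lambda_functor : functor (Rep L) (Rep A) :=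
  @Functor (Rep L) (Rep A) (@Lambda k n) (@Lambda_map k n)
    Lambda_map1 Lambda_mapM.

Lemma Pi_map1 (V : Rep A) : Pi_map (lin_id V) = lin_id (Pi V).
Proof.
apply: linear_ext => x; have [t [v ->]] := Pi_class_surj x.
exact: (Pi_fun_class (lin_id V)).
Qed.

Lemma Pi_mapM (U V W : Rep A) (g : {linear V -> W}) (f : {linear U -> V}) :
  Pi_map (lin_comp g f) = lin_comp (Pi_map g) (Pi_map f).
Proof.
apply: linear_ext => x; have [t [v ->]] := Pi_class_surj x.
rewrite /Pi_map /lin_comp /=.
by rewrite (Pi_fun_class (lin_comp g f)) !Pi_fun_class.
Qed.

Definition Pi_functor : functor (Rep A) (Rep L) :=
  @Functor (Rep A) (Rep L) (@Pi k n) (@Pi_map k n) Pi_map1 Pi_mapM.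

Definition canonical_map (W : lmodType L^c) (w : W) : Pi (Lambda W) :=
  Pi_class (fun _ : leaf trivial_tree => w : Lambda W).
End Functors.
Arguments canonical_map {k n} W w.

(* Main.v *)
Require Import Defs.
From HB Require Import structures.
From mathcomp Require Import all_boot all_order all_algebra.
From mathcomp Require Import finmap.
From mathcomp.multinomials Require Import monalg.

Set Implicit Arguments.
Unset Strict Implicit.
Unset Printing Implicit Defensive.

Import GRing.Theory.
Local Open Scope ring_scope.

(* In a right L-module every x is the sum of the x e_i f_i, where f_i is the star
   of e_i, so x is determined by the x e_i. In Pi (Lambda W) this reduces
   L-linearity of j_W to the commutation with the e_i and with scalars, and it
   shows by induction on t that [t, v] is in the image: if [t_i, v_i] = j_W w_i
   for all i, then [t, v] is the image of the sum of the w_i f_i. In W it gives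
   injectivity: if j_W w = j_W w', then w and w' agree after acting by all long
   enough words. *)

(** Every element is a finite sum of scaled words, and a scaled word is a product of generators
    ending in a scalar. Applied to lifts along [leavitt_pi], this reduces L-linearity of j_W to
    generators and scalars. *)
Lemma free_alg_gen_ind (k : fieldType) (X : choiceType) (P : free_alg k X -> Prop) :
  (forall c, P (c *: 1)) -> (forall x, P (gen k x)) ->
  (forall a b, P a -> P b -> P (a + b)) ->
  (forall a b, P a -> P b -> P (a * b)) ->
  forall a, P a.
Proof.
move=> PC Pgen PD PM a.
have PU c (s : seq X) : P (<< c *g FMonom s >> : {malg k[{fmonom X}]}).
  elim: s => [|x s IH].
    have -> : (<< c *g FMonom [::] >> : {malg k[{fmonom X}]}) = c *: 1.
      by apply/malgP => w; rewrite mcoeffZ !mcoeffU -fmoneE mulr_natr.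
    exact: PC.
  have -> : (<< c *g FMonom (x :: s) >> : {malg k[{fmonom X}]})
      = << fmu x >> * << c *g FMonom s >>.
    rewrite (malgMEw msuppU_le msuppU_le) !big_seq_fset1 !mcoeffUU mul1r fmuE.
    by congr (<< _ *g _ >>); rewrite [RHS]fmmulE.
  exact: PM (Pgen x) IH.
rewrite (monalgE a); apply: big_ind => [||w _] //.
  by have := PC 0; rewrite scale0r.
by case: w => s; exact: PU.
Qed.

Section LeavittModule.
Variables (k : fieldType) (n : nat) (W : lmodType (leavitt k n)^c).
Implicit Types w : W.

Lemma ract_sumr (I : Type) (r : seq I) (F : I -> leavitt k n) w :
  w ** (\sum_(i <- r) F i) = \sum_(i <- r) w ** F i.
Proof. exact: scaler_suml. Qed.

Lemma ract_suml (I : Type) (r : seq I) (F : I -> W) (b : leavitt k n) :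
  (\sum_(i <- r) F i) ** b = \sum_(i <- r) F i ** b.
Proof. exact: scaler_sumr. Qed.

Lemma ract_e_inj w w' :
  (forall i, w ** leavitt_e k i = w' ** leavitt_e k i) -> w = w'.
Proof.
move=> eqw; rewrite -(ract1 w) -(ract1 w') -leavitt_sum_e_es !ract_sumr.
by apply: eq_bigr => i _; rewrite -!ractA eqw.
Qed.

Lemma ract_es_e w i j :
  w ** leavitt_es k i ** leavitt_e k j = if i == j then w else 0.
Proof.
by rewrite ractA leavitt_es_e; case: (i == j); [exact: ract1 | exact: scale0r].
Qed.

(** By induction on the length bound, [ract_e_inj] peels off first letters until the empty word,
    which acts as 1. *)
Lemma ract_words_inj w w' :
  long_words (fun u => w ** iota_alg (word_alg k u) = w' ** iota_alg (word_alg k u)) ->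
  w = w'.
Proof.
case=> N; elim: N w w' => [|N IH] w w' eqw.
  by have := eqw [::] isT; rewrite word_alg_nil rmorph1 !ract1.
apply: ract_e_inj => i; apply: IH => u le_u.
by have := eqw (i :: u) le_u; rewrite word_alg_cons rmorphM /= iota_alg_gen -!ractA.
Qed.

End LeavittModule.

Section CanonicalMap.
Variables (k : fieldType) (n : nat) (W : lmodType (leavitt k n)^c).
Notation L := (leavitt k n).
Notation j := (canonical_map W).

Lemma canonical_mapD : {morph j : w w' / w + w'}.
Proof. by move=> w w'; rewrite /canonical_map Pi_classD. Qed.

Lemma canonical_map0 : j 0 = 0.
Proof. by apply: (addrI (j 0)); rewrite -canonical_mapD !addr0. Qed.

(** The tree of j w is trivial, so the first clause of [dedge] applies and gives the class
    [I, w e_i]. *)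
Lemma canonical_map_e w i : j (w ** leavitt_e k i) = j w ** leavitt_e k i.
Proof.
rewrite /ract -[RHS]/(Pi_act _ _) Pi_act_pi free_act_gen /=.
by rewrite /canonical_map [RHS]Pi_edge_dclass /dedge /= Lambda_ract iota_alg_gen.
Qed.

(** After acting by any e_i', the relation f_i e_i' = delta makes both sides j w or 0, so no caret
    needs to be computed. *)
Lemma canonical_map_es w i : j (w ** leavitt_es k i) = j w ** leavitt_es k i.
Proof.
apply: ract_e_inj => i'; rewrite -canonical_map_e !ract_es_e.
by case: (i == i'); rewrite ?canonical_map0.
Qed.

Lemma canonical_map_scalar w (c : k) :
  j (w ** (c *: (1 : L))) = j w ** (c *: (1 : L)).
Proof.
rewrite Pi_classZ /canonical_map Lambda_ract.
by rewrite [iota_alg _]linearZ rmorph1.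
Qed.

Lemma canonical_map_ract w (b : L) : j (w ** b) = j w ** b.
Proof.
(* The vector w stays general: in the product case the hypothesis on b is used at w acted on by
   a. *)
elim/leavitt_ind: b => a; move: w.
elim/free_alg_gen_ind: a => [c|[i|i]|a b IHa IHb|a b IHa IHb] w.
- by rewrite leavitt_piZE; exact: canonical_map_scalar.
- exact: canonical_map_e.
- exact: canonical_map_es.
- by rewrite leavitt_piD !ractDr canonical_mapD IHa IHb.
- by rewrite leavitt_piME -!ractA IHb IHa.
Qed.

Lemma canonical_map_linear : linear j.
Proof.
move=> b w w'; rewrite canonical_mapD; congr (_ + _).
exact: canonical_map_ract.
Qed.

Lemma canonical_map_inj : injective j.
Proof.
move=> w w' /dclassP[N eqN]; apply: ract_words_inj; exists N => u le_u.
(* By conversion, the value of (I, w) at a word u is w acted on by the image of u under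
   [iota_alg]. *)
exact: eqN.
Qed.

Lemma canonical_map_surj x : exists w, j w = x.
Proof.
have [t [v ->]] := Pi_class_surj x.
elim: t v => [|f IH] v.
  by exists (v tt); congr (dclass (decorate _)); apply/boolp.funext => -[].
have [w jw] := boolp.choice (fun i => IH i (fun l => v (subleaf l))).
exists (\sum_i w i ** leavitt_es k i); apply: ract_e_inj => i.
(* Acting by e_i leaves the ith subtree on the right, which is j (w i); on the left only the ith
   summand survives. *)
rewrite -canonical_map_e Pi_class_e -jw ract_suml; congr j.
rewrite (bigD1 i) //= ract_es_e eqxx big1 ?addr0 // => i' /negbTE ne.
by rewrite ract_es_e ne.
Qed.

Lemma canonical_map_bij : bijective j.
Proof.
have [g gK] := boolp.choice canonical_map_surj.
by exists g => // w; apply: canonical_map_inj; rewrite gK.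
Qed.

HB.instance Definition _ :=
  GRing.isLinear.Build L^c W (Pi (Lambda W)) *:%R j canonical_map_linear.

Definition canonical_lin : {linear W -> Pi (Lambda W)} := j.

End CanonicalMap.

Lemma bijective_is_iso (R : pzRingType) (U V : Rep R) (f : {linear U -> V}) :
  bijective f -> @is_iso (Rep R) U V f.
Proof.
case=> g fK gK.
pose gM := GRing.isLinear.Build R^c V U *:%R g (can2_linear fK gK).
pose G : {linear V -> U} := HB.pack g gM.
by exists G; split; apply: linear_ext => x /=; rewrite ?fK ?gK.
Qed.

(** Both composites send w to [I, f w]. *)
Lemma canonical_lin_natural (k : fieldType) (n : nat) :
  @is_natural (Rep (leavitt k n)) (Rep (leavitt k n)) (id_functor _)
    (comp_functor (Pi_functor k n) (Lambda_functor k n)) (@canonical_lin k n).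
Proof.
move=> W W' f; apply: linear_ext => w.
by symmetry; exact: (Pi_fun_class (Lambda_map f)).
Qed.

Theorem proposition1p6 (k : fieldType) (n : nat) (hn : (2 <= n)%N) :
  (forall W : lmodType (leavitt k n)^c,
     linear (canonical_map W) /\ bijective (canonical_map W))
  /\
  (exists j : forall W : lmodType (leavitt k n)^c, {linear W -> Pi (Lambda W)},
     (forall (W : lmodType (leavitt k n)^c) (w : W), j W w = canonical_map W w) /\
     @is_natural_iso (Rep (leavitt k n)) (Rep (leavitt k n))
       (id_functor (Rep (leavitt k n)))
       (comp_functor (Pi_functor k n) (Lambda_functor k n)) j)
  /\
  (forall W : Rep (leavitt k n), exists V : Rep (free_alg k 'I_n),
     isomorphic W (Pi_functor k n V)).
Proof.
split.
  by move=> W; split; [exact: canonical_map_linear | exact: canonical_map_bij].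
have isoJ (W : Rep (leavitt k n)) :
    @is_iso (Rep (leavitt k n)) W (Pi (Lambda W)) (canonical_lin W).
  by apply: bijective_is_iso; exact: canonical_map_bij.
split; last by move=> W; exists (Lambda W), (canonical_lin W); exact: isoJ.
exists (@canonical_lin k n); split=> //; split; last exact: isoJ.
exact: canonical_lin_natural.
Qed.
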